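(* Let $\mathbb{B}$ be a separable Banach space ordered by a cone $\mathcal{K}$ with nonempty interior, let $X\subseteq\mathbb{B}$, and let $\Phi$ be a strongly monotone semiflow on $X$. Then $Q$ is prevalent in $B$, i.e. $B\setminus Q$ is shy in $\mathbb{B}$. If moreover the Improved Limit Set Dichotomy holds for $\Phi$, then $C$ is prevalent in $B$, i.e. $B\setminus C$ is shy in $\mathbb{B}$.
   Context: An order cone $\mathcal{K}\subset\mathbb{B}$ is a closed convex cone with $\mathcal{K}\cap(-\mathcal{K})=\{0\}$ and $\mathcal{K}\neq\{0\}$. Write $x\le y$ iff $y-x\in\mathcal{K}$; $x<y$ iff $x\le y$ and $x\ne y$. For sets, $A\le A'$ (resp. $A<A'$) means $a\le a'$ (resp. $a<a'$) for all $a\in A$, $a'\in A'$. For $x,y\in X$, $x\ll y$ means there are open neighborhoods $U,V$ (in $X$) of $x,y$ with $U\le V$. A semiflow on $X$ is a continuous map $\Phi:[0,\infty)\times X\to X$, $(t,x)\mapsto\Phi_t(x)$, with $\Phi_0=\mathrm{id}$ and $\Phi_t\circ\Phi_s=\Phi_{t+s}$. It is strongly monotone if it is monotone ($x\le y$ implies $\Phi_t(x)\le\Phi_t(y)$ for $t\ge0$) and $x<y$ implies $\Phi_t(x)\ll\Phi_t(y)$ for all $t>0$. $O(x)=\{\Phi_t(x):t\ge0\}$ is the orbit, $\omega(x)\subseteq X$ the omega limit set of $x$ (limits in $X$ of $\Phi_{t_k}(x)$ with $t_k\to\infty$), and $E=\{x\in X:\Phi_t(x)=x\ \forall t\ge 0\}$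 the set of equilibria. Define - $B=\{x\in X: O(x)\text{ has compact closure in }X\}$, - $Q=\{x\in X:\omega(x)\subseteq E\}$, - $C=\{x\in X:\omega(x)=\{e\}\text{ for some }e\in E\}$. Improved Limit Set Dichotomy: for all $x<y$ in $X$, either $\omega(x)<\omega(y)$, or $\omega(x)=\omega(y)=\{e\}$ for some $e\in E$. A set $W\subseteq\mathbb{B}$ is shy if there is a nontrivial compactly supported Borel measure $\mu$ on $\mathbb{B}$ with $\mu(W+x)=0$ for every $x\in\mathbb{B}$ (for a set that is not Borel, $\mu(S)=0$ means that $S$ is contained in a Borel set of $\mu$-measure zero). Given $A\subseteq\mathbb{B}$, $W$ is prevalent in $A$ if $A\setminus W$ is shy. *)

(* Defs.v *)
From HB Require Import structures.
From mathcomp Require Import all_boot all_order all_algebra.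
From mathcomp Require Import all_classical all_reals all_analysis.

Set Implicit Arguments.
Unset Strict Implicit.
Unset Printing Implicit Defensive.

Import Order.TTheory GRing.Theory Num.Theory.
Import numFieldNormedType.Exports.

Local Open Scope classical_set_scope.
Local Open Scope ring_scope.

Definition separable (T : topologicalType) : Prop :=
  exists2 D : set T, countable D & dense D.

Section Order.
Context {R : realType} {V : normedModType R}.
Implicit Types (K X : set V) (x y : V).

Record order_cone K : Prop := OrderCone {
  order_cone_closed : closed K;
  order_cone_convex : convex_set (K : set (convex_lmodType V));
  order_cone_scale : forall (a : R) x, 0 <= a -> K x -> K (a *: x);
  order_cone_pointed : K `&` [set - x | x in K] = [set 0];
  order_cone_neq0 : K <> [set 0]
}.

Definition cone_le K x y : Prop := K (y - x).

Definition cone_lt K x y : Prop := cone_le K x y /\ x <> y.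

Definition set_le K (A A' : set V) : Prop :=
  forall a a', A a -> A' a' -> cone_le K a a'.

Definition set_lt K (A A' : set V) : Prop :=
  forall a a', A a -> A' a' -> cone_lt K a a'.

(* The neighborhoods are relatively open in X, i.e., traces on X of open
   subsets of V; x and y are meant to be points of X. *)
Definition cone_ll K X x y : Prop :=
  exists U U' : set V,
    [/\ open U /\ U x, open U' /\ U' y & set_le K (X `&` U) (X `&` U')].

End Order.

Section Semiflow.
Context {R : realType} {V : normedModType R}.
Implicit Types (K X : set V) (Phi : R -> V -> V) (x : V).

(* A semiflow on X is the restriction of Phi to [0, +oo[ x X; the values of
   Phi elsewhere are irrelevant. *)
Record semiflow X Phi : Prop := Semiflow {
  semiflow_stable : forall (t : R) x, 0 <= t -> X x -> X (Phi t x);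
  semiflow_continuous :
    {within [set t : R | 0 <= t] `*` X, continuous (fun p => Phi p.1 p.2)};
  semiflow0 : forall x, X x -> Phi 0 x = x;
  semiflowD : forall (t s : R) x, 0 <= t -> 0 <= s -> X x ->
    Phi t (Phi s x) = Phi (t + s) x
}.

Definition monotone_semiflow K X Phi : Prop :=
  forall x y, X x -> X y -> cone_le K x y ->
  forall t, 0 <= t -> cone_le K (Phi t x) (Phi t y).

Definition strongly_monotone_semiflow K X Phi : Prop :=
  monotone_semiflow K X Phi /\
  forall x y, X x -> X y -> cone_lt K x y ->
  forall t, 0 < t -> cone_ll K X (Phi t x) (Phi t y).

Definition orbit Phi x : set V := [set Phi t x | t in [set t : R | 0 <= t]].

Definition omega_limit X Phi x : set V :=
  [set p | X p /\ exists t : nat -> R,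
    [/\ forall k, 0 <= t k, t @ \oo --> +oo &
        (fun k => Phi (t k) x) @ \oo --> p]].

Definition equilibria X Phi : set V :=
  [set x | X x /\ forall t, 0 <= t -> Phi t x = x].

(* The closure of the orbit is taken in X, hence the intersection with X. *)
Definition compact_orbit_points X Phi : set V :=
  [set x | X x /\ compact (closure (orbit Phi x) `&` X)].

Definition quasiconvergent_points X Phi : set V :=
  [set x | X x /\ omega_limit X Phi x `<=` equilibria X Phi].

Definition convergent_points X Phi : set V :=
  [set x | X x /\ exists2 e, equilibria X Phi e & omega_limit X Phi x = [set e]].

Definition improved_limit_set_dichotomy K X Phi : Prop :=
  forall x y, X x -> X y -> cone_lt K x y ->
  set_lt K (omega_limit X Phi x) (omega_limit X Phi y) \/
  exists2 e, equilibria X Phi e &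
    omega_limit X Phi x = [set e] /\ omega_limit X Phi y = [set e].

End Semiflow.

Section Prevalence.
Context {R : realType} {V : completeNormedModType R}.

Definition borelType : measurableType (@open V).-sigma :=
  g_sigma_algebraType (@open V).

(* Finiteness of mu is part of the usual convention for shy sets: if infinite
   values were allowed on compact sets, the measure that is 0 on the meager
   Borel sets and +oo on the others would make every meager set shy. Compact
   support means that mu vanishes outside a compact set. *)
Definition shy (W : set V) : Prop :=
  exists mu : {finite_measure set borelType -> \bar R},
    [/\ mu setT <> 0%E,
        exists2 C : set V, compact C & mu (~` C) = 0%E &
        forall x : V, mu.-negligible ([set w + x | w in W] : set borelType)].

Definition prevalent_in (W A : set V) : Prop := shy (A `\` W).

End Prevalence.

(* Main.v *)
(* Two ordered points x < y of B either satisfy omega(x) < omega(y) or have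
   omega(y) contained in E. Indeed limit sets contain no two ordered points;
   if omega(y) is contained in omega(x), common subsequential limits coincide
   and are equilibria (colimiting); otherwise some q in omega(y) is not in
   omega(x), a continuation argument in s shows Phi_s(p) <= q for all s >= 0 and
   some p in omega(x), and two absorption steps give omega(x) < omega(y).
   Hence, on a line directed by v in K, the limit sets of the exceptional points
   are linearly ordered. Choosing p_x in each omega(x), an accumulation point p_x
   of the family would be a least or greatest element of omega(x), which would
   then be a single equilibrium. So the family is isolated, hence countable by
   separability, and Lebesgue measure on the segment [0, v] witnesses shyness: no
   measurability of the exceptional set is needed, because the complement of the
   segment is Borel and null. *)
Require Import Defs.
From HB Require Import structures.
From mathcomp Require Import all_boot all_order all_algebra.
From mathcomp Require Import all_classical all_reals all_analysis.
From mathcomp Require Import measurable_realfun lra.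

Set Implicit Arguments.
Unset Strict Implicit.
Unset Printing Implicit Defensive.

Import Order.TTheory GRing.Theory Num.Theory.
Import numFieldNormedType.Exports.

Local Open Scope classical_set_scope.
Local Open Scope ring_scope.

(** * Compactness, continuation and separation by balls *)

(** Stands in for subsequence extraction: choose a witness in [A] for each [n] and a cluster point
    [p] of this sequence; as [P] decreases in [n], the tail from [n] on satisfies [P n]. *)
Lemma compact_nested_cluster (R : realType) (V : normedModType R) (A : set V)
    (P : nat -> V -> Prop) : compact A ->
  (forall n, exists2 w, A w & P n w) -> (forall n w, P n.+1 w -> P n w) ->
  exists2 p, A p & forall e n, 0 < e -> exists w, [/\ A w, P n w & ball p e w].
Proof.
move=> cA exP decP.
have /choice[w wP] : forall n, exists w, A w /\ P n w.
  by move=> n; have [w] := exP n; exists w.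
have Pmn m n z : (n <= m)%N -> P m z -> P n z.
  move=> /subnK <-; elim: (m - n)%N => // k IH; rewrite addSn => /decP; exact: IH.
have [|p [Ap clp]] := cA (w @ \oo) _.
  by exists 0%N => // n _; exact: (wP n).1.
exists p => // e n e0.
have [||z [[Az Pz] bz]] := clp [set z | A z /\ P n z] (ball p e).
- by exists n => // m /= nm; split; [exact: (wP m).1|exact: Pmn nm (wP m).2].
- exact: nbhsx_ballx.
- by exists z.
Qed.

(** The infimum of the counterexamples has none below it, so the step clears an interval to its
    right, which is absurd. The base case is the step at [r = 0], whose assumption is vacuous. *)
Lemma real_induction (R : realType) (P : R -> Prop) :
  (forall r, 0 <= r -> (forall s, 0 <= s < r -> P s) ->
     exists2 d, 0 < d & forall s, r <= s < r + d -> P s) ->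
  forall r, 0 <= r -> P r.
Proof.
move=> step r0 r00; apply: contrapT => nP.
pose S := [set r | 0 <= r /\ ~ P r].
have S0 : S !=set0 by exists r0.
have lbS : has_lbound S by exists 0 => s [].
have hS : has_inf S by split.
have m0 : 0 <= inf S by apply: (lb_le_inf S0) => s [].

have [|d d0 dP] := step _ m0.
  move=> s /andP[s0 sm]; apply: contrapT => nPs.
  by have /(ge_inf lbS) := (conj s0 nPs : S s); rewrite leNgt sm.
have [s [s0 nPs] sd] := inf_adherent d0 hS.
by have mS := ge_inf lbS (conj s0 nPs); apply: nPs; apply: dP; rewrite sd mS.
Qed.

Lemma additive_nat_mul (R : numDomainType) (P : R -> Prop) (s : R) :
  P 0 -> P s -> 0 <= s ->
  (forall a b, 0 <= a -> 0 <= b -> P a -> P b -> P (a + b)) ->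
  forall n : nat, P (n%:R * s).
Proof.
move=> P0 Ps s0 PD; elim=> [|n IH]; first by rewrite mul0r.
by rewrite mulrSr mulrDl mul1r; apply: PD => //; rewrite mulr_ge0.
Qed.

Lemma ball_separate (R : realType) (V : normedModType R) (p q : V) : p <> q ->
  exists2 e : R, 0 < e & forall a b, ball p e a -> ball q e b -> a <> b.
Proof.
move=> /eqP pq; have pq0 : 0 < `|p - q| by rewrite normr_gt0 subr_eq0.
exists (`|p - q| / 2) => [|a b pa + ab]; first by rewrite divr_gt0.
rewrite -ab => /ball_sym qa; have := ball_split pa qa.
by rewrite -ball_normE /= ltxx.
Qed.

(** * Ordered flows and the epsilon form of limits *)

Section Flow.
Context {R : realType} {V : normedModType R}.
Implicit Types (le : V -> V -> Prop) (X : set V) (Phi : R -> V -> V).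

(* Only the order relation enters the dynamical arguments; abstracting it from
   the cone makes order duality available (ordered_flow_flip). *)
Record ordered_flow le X Phi : Prop := OrderedFlow {
  of_refl : forall x, le x x;
  of_trans : forall y x z, le x y -> le y z -> le x z;
  of_anti : forall x y, le x y -> le y x -> x = y;
  of_closed : forall x y, (forall e : R, 0 < e ->
    exists a b, [/\ ball x e a, ball y e b & le a b]) -> le x y;
  of_stable : forall (t : R) x, 0 <= t -> X x -> X (Phi t x);
  of_cont : forall (t : R) x e, 0 <= t -> X x -> 0 < e -> exists2 d : R, 0 < d &
    forall s z, 0 <= s -> X z -> `|s - t| < d -> ball x d z ->
    ball (Phi t x) e (Phi s z);
  of_Phi0 : forall x, X x -> Phi 0 x = x;
  of_PhiD : forall (t s : R) x, 0 <= t -> 0 <= s -> X x ->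
    Phi t (Phi s x) = Phi (t + s) x;
  of_mono : forall (t : R) x y, 0 <= t -> X x -> X y -> le x y ->
    le (Phi t x) (Phi t y);
  of_strong : forall (t : R) x y, 0 < t -> X x -> X y -> le x y -> x <> y ->
    exists2 e : R, 0 < e & forall a b, X a -> X b ->
      ball (Phi t x) e a -> ball (Phi t y) e b -> le a b
}.

Lemma ordered_flow_flip le X Phi :
  ordered_flow le X Phi -> ordered_flow (fun x y => le y x) X Phi.
Proof.
case=> refl trans anti cl st ct P0 PD mono strong; split => //.
- by move=> y x z xy yz; exact: (trans _ _ _ yz xy).
- by move=> x y xy yx; exact: (anti _ _ yx xy).
- move=> x y H; apply: cl => e /H[a [b [xa yb ba]]]; by exists b, a.
- by move=> t x y t0 Xx Xy; exact: mono.
- move=> t x y t0 Xx Xy yx xy.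
  have [|e e0 H] := strong t _ _ t0 Xy Xx yx; first exact/nesym.
  by exists e => // a b Xa Xb xa yb; exact: H.
Qed.

(* Phi_(t_k) x --> p and Phi_(t_k) y --> q along a common sequence t_k --> +oo,
   in epsilon form. *)
Definition colimit Phi x y p q := forall e T : R, 0 < e ->
  exists t, [/\ T <= t, 0 <= t, ball p e (Phi t x) & ball q e (Phi t y)].

(** Such an [A] is closed, so it also contains the limit points of the orbit, which thereby lie in
    [X]. *)
Definition compact_orbit X Phi x := exists A : set V,
  [/\ compact A, A `<=` X & forall t, 0 <= t -> A (Phi t x)].

Lemma omega_limitP X Phi x p :
  omega_limit X Phi x p <-> X p /\ colimit Phi x x p p.
Proof.
split=> [[Xp [t [t0 toy tp]]]|[Xp H]]; split => //.
- move=> e T e0.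
  have /cvgryPge /(_ T) tT := toy.
  have [N _ /(_ N (leqnn N)) [/= ? ?]] := filterI tT (cvg_ball tp e0).
  by exists (t N); split.
- have /choice[t tP] : forall k : nat, exists t, [/\ k%:R <= t, 0 <= t &
      ball p k.+1%:R^-1 (Phi t x)].
    move=> k; have [|t [? ? ? _]] := H k.+1%:R^-1 k%:R; first by rewrite invr_gt0.
    by exists t; split.
  exists t; split.
  + by move=> k; have [] := tP k.
  + apply/cvgryPge => M; near=> k.
    have [kt _ _] := tP k; apply: le_trans kt; near: k.
    exact: nbhs_infty_ger.
  + apply/cvg_ballP => e e0; near=> k.
    have [_ _] := tP k; apply: le_ball.
    near: k; have := (near_infty_natSinv_lt (PosNum e0)).
    by apply: filterS => k /ltW.
Unshelve. all: by end_near. Qed.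

(** * Invariance and compactness of limit sets *)

Section Theory.
Variables (le : V -> V -> Prop) (X : set V) (Phi : R -> V -> V).
Hypothesis flow : ordered_flow le X Phi.
Local Notation w := (omega_limit X Phi).
Local Notation cpt := (compact_orbit X Phi).

Lemma flow_cont_space t x e : 0 <= t -> X x -> 0 < e -> exists2 d : R, 0 < d &
  forall z, X z -> ball x d z -> ball (Phi t x) e (Phi t z).
Proof.
move=> t0 Xx e0; have [d d0 dP] := of_cont flow t0 Xx e0.
by exists d => // z Xz xz; apply: dP => //; rewrite subrr normr0.
Qed.

Lemma flow_cont_time t x e : 0 <= t -> X x -> 0 < e -> exists2 d : R, 0 < d &
  forall s, 0 <= s -> `|s - t| < d -> ball (Phi t x) e (Phi s x).
Proof.
move=> t0 Xx e0; have [d d0 dP] := of_cont flow t0 Xx e0.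
by exists d => // s s0 st; apply: dP => //; exact: ballxx.
Qed.

Lemma omega_in x p : w x p -> X p. Proof. by case. Qed.

Lemma omega_shift x p s : X x -> 0 <= s -> w x p -> w x (Phi s p).
Proof.
move=> Xx s0 /omega_limitP[Xp H]; apply/omega_limitP; split.
  exact: of_stable flow _ _ _ _.
move=> e T e0; have [d d0 dP] := flow_cont_space s0 Xp e0.
have [t [Tt t0 pt _]] := H d (T - s) d0.
exists (s + t); rewrite -(of_PhiD flow) //.
have := dP _ (of_stable flow t0 Xx) pt.
by split => //; lra.
Qed.

Lemma omega_closed x p : X p ->
  (forall e : R, 0 < e -> exists2 z, w x z & ball p e z) -> w x p.
Proof.
move=> Xp H; apply/omega_limitP; split => // e T e0.
have [|z /omega_limitP[_ xz] pz] := H (e / 2); first by rewrite divr_gt0.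
have [|t [Tt t0 zt _]] := xz (e / 2) T; first by rewrite divr_gt0.
by exists t; split => //; exact: ball_split pz zt.
Qed.

Lemma colimit_le x y p q a b T : X x -> X y -> X p -> X q -> 0 <= a -> 0 <= b ->
  colimit Phi x y p q ->
  (forall t, 0 <= t -> T <= t -> le (Phi a (Phi t x)) (Phi b (Phi t y))) ->
  le (Phi a p) (Phi b q).
Proof.
move=> Xx Xy Xp Xq a0 b0 xypq H; apply: (of_closed flow) => e e0.
have [d d0 dP] := flow_cont_space a0 Xp e0.
have [d' d'0 d'P] := flow_cont_space b0 Xq e0.
have [|t [Tt t0 pt qt]] := xypq (Num.min d d') T; first by rewrite lt_min d0.
exists (Phi a (Phi t x)), (Phi b (Phi t y)); split; last exact: H.
- apply: dP; first exact: of_stable flow _ _ _ _.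
  by apply: le_ball pt; rewrite ge_min lexx.
- apply: d'P; first exact: of_stable flow _ _ _ _.
  by apply: le_ball qt; rewrite ge_min lexx orbT.
Qed.

Lemma colimit_mono x y p q : X x -> X y -> X p -> X q -> le x y ->
  colimit Phi x y p q -> le p q.
Proof.
move=> Xx Xy Xp Xq xy xypq; rewrite -(of_Phi0 flow Xp) -(of_Phi0 flow Xq).
apply: (colimit_le (T := 0)) xypq _ => // t t0 _.
by rewrite !(of_Phi0 flow); first exact: of_mono flow _ _ _ _ _ _ _;
  exact: of_stable flow _ _ _ _.
Qed.

Lemma colimit_exists x y q : cpt x -> w y q ->
  exists p, [/\ X p, w x p & colimit Phi x y p q].
Proof.
move=> [A [cA AX Ax]] /omega_limitP[Xq yq].
have [||p Ap pP] := @compact_nested_cluster _ _ A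
  (fun n z => exists t, [/\ n%:R <= t, 0 <= t, ball q n.+1%:R^-1 (Phi t y)
    & z = Phi t x]) cA.
- move=> n; have [|t [nt t0 qt _]] := yq n.+1%:R^-1 n%:R.
    by rewrite invr_gt0.
  by exists (Phi t x); [exact: Ax|exists t; split].
- move=> n z [t [nt t0 qt zt]]; exists t; split => //.
    by apply: le_trans nt; rewrite ler_nat.
  by apply: le_ball qt; rewrite lef_pV2 ?posrE// ler_nat.
- have cpq : colimit Phi x y p q.
    move=> e T e0.
    have [N _ /(_ N (leqnn N)) [/= TN Ne]] :=
      filterI (nbhs_infty_ger T) (near_infty_natSinv_lt (PosNum e0)).
    have [z [_ [t [Nt t0 qt ->]] pz]] := pP e N e0.
    exists t; split => //; first exact: le_trans Nt.
    by apply: le_ball qt; exact: ltW.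
  exists p; split => //; first exact: AX.
  apply/omega_limitP; split; first exact: AX.
  by move=> e T /(cpq e T)[t [? ? ? _]]; exists t; split.
Unshelve. all: by end_near. Qed.

Lemma omega_nonempty x : cpt x -> w x !=set0.
Proof.
move=> [A [cA AX Ax]].
have [||c Ac cP] := @compact_nested_cluster _ _ A
  (fun n z => exists t, [/\ n%:R <= t, 0 <= t & z = Phi t x]) cA.
- by move=> n; exists (Phi n%:R x); [exact: Ax|exists n%:R].
- move=> n z [t [nt t0 zt]]; exists t; split => //.
  by apply: le_trans nt; rewrite ler_nat.
- exists c; apply/omega_limitP; split; first exact: AX.
  move=> e T e0; have [N _ /(_ N (leqnn N)) /= TN] := nbhs_infty_ger T.
  have [z [_ [t [Nt t0 ->]] zc]] := cP e N e0.
  by exists t; split => //; exact: le_trans Nt.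
Qed.

(** When [Phi (t + s) x] approaches [z] at late times [s], the points [Phi s x] cluster at some [z']
    by compactness, and continuity of [Phi t] sends [z'] to [z]. *)
Lemma omega_preimage x z t : X x -> cpt x -> 0 <= t -> w x z ->
  exists2 z', w x z' & Phi t z' = z.
Proof.
move=> Xx [A [cA AX Ax]] t0 /omega_limitP[Xz xz].
have [||p Ap pP] := @compact_nested_cluster _ _ A
  (fun n u => exists s, [/\ n%:R <= s, 0 <= s, ball z n.+1%:R^-1 (Phi (t + s) x)
    & u = Phi s x]) cA.
- move=> n; have [|s [ns s0 qs _]] := xz n.+1%:R^-1 (t + n%:R).
    by rewrite invr_gt0.
  have n0 : 0 <= n%:R :> R by [].
  exists (Phi (s - t) x); first by apply: Ax; lra.
  by exists (s - t); split => //; [lra|lra|rewrite subrKC].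
- move=> n u [s [ns s0 qs us]]; exists s; split => //.
    by apply: le_trans ns; rewrite ler_nat.
  by apply: le_ball qs; rewrite lef_pV2 ?posrE// ler_nat.
- exists p.
    apply/omega_limitP; split; first exact: AX.
    move=> e T e0.
    have [N _ /(_ N (leqnn N)) /= TN] := nbhs_infty_ger T.
    have [u [_ [s [Ns s0 qs ->]] pz]] := pP e N e0.
    by exists s; split => //; exact: le_trans Ns.
  apply: contrapT => /ball_separate[e e0 sep].
  have [d d0 dP] := flow_cont_space t0 (AX _ Ap) e0.
  have [N _ /(_ N (leqnn N)) /= Ne] := near_infty_natSinv_lt (PosNum e0).
  have [u [Au [s [Ns s0 qs us]] pz]] := pP d N d0.
  apply: sep (dP _ (AX _ Au) pz) (le_ball (ltW Ne) qs) _.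
  by rewrite us (of_PhiD flow).
Qed.

(** * Strictness of the flow and convergence *)

(** An orbit cannot reach an isolated point of [X] from elsewhere: just before the first arrival it
    would be within [e] of the point, hence equal to it. *)
Lemma flow_isolated x t e : X x -> 0 <= t -> 0 < e ->
  (forall a, X a -> ball (Phi t x) e a -> a = Phi t x) -> x = Phi t x.
Proof.
move=> Xx t0 e0 iso; apply: contrapT => xt.
suff : forall s, 0 <= s -> Phi s x <> Phi t x by move=> /(_ t t0).
apply: real_induction => r r0 IH.
have rt : Phi r x <> Phi t x.
  move=> rt; have [r00|rn0] := eqVneq r 0.
    by apply: xt; rewrite -rt r00 (of_Phi0 flow).
  have rpos : 0 < r by rewrite lt_neqAle eq_sym rn0.
  have [d d0 dP] := flow_cont_time r0 Xx e0.
  pose m := Num.min d r; have [md mr] : m <= d /\ m <= r.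
    by rewrite /m !ge_min !lexx orbT.
  have m0 : 0 < m by rewrite lt_min d0.
  have s0 : 0 <= r - m / 2 by lra.
  apply: (IH (r - m / 2)); first by apply/andP; split; lra.
  apply: iso; first exact: of_stable flow _ _ _ _.
  rewrite -rt; apply: dP => //.
  rewrite addrAC subrr add0r normrN gtr0_norm; lra.
have [e' e'0 sep] := ball_separate rt.
have [d d0 dP] := flow_cont_time r0 Xx e'0.
exists d => // s /andP[rs sd]; apply: sep (ballxx _ e'0).
by apply: dP; [lra|rewrite ger0_norm; lra].
Qed.

(** If the images agreed, points of [X] near the common image would lie both above and below it. It
    would be isolated in [X], so [x] and [y] would both equal it already. *)
Lemma flow_strict x y t : X x -> X y -> le x y -> x <> y -> 0 < t ->
  Phi t x <> Phi t y.
Proof.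
move=> Xx Xy xy nxy t0 txy.
have [e e0 eP] := of_strong flow t0 Xx Xy xy nxy.
have Xt : X (Phi t x) by exact: of_stable flow _ _ (ltW t0) Xx.
have iso a : X a -> ball (Phi t x) e a -> a = Phi t x.
  move=> Xa ta; apply: (of_anti flow); apply: eP => //; rewrite -?txy //;
  exact: ballxx.
apply: nxy; rewrite (flow_isolated Xx (ltW t0) e0 iso) txy; apply/esym.
by apply: (flow_isolated Xy (ltW t0) e0) => a; rewrite -txy; exact: iso.
Qed.

Lemma small_periods_equilibrium p e : X p -> 0 < e ->
  (forall s, 0 <= s <= e -> Phi s p = p) -> equilibria X Phi p.
Proof.
move=> Xp e0 per; split => // t t0.
pose n := (Num.truncn (t / e)).+1.
have n0 : 0 < n%:R :> R by [].
have tn : t / n%:R <= e.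
  rewrite ler_pdivrMr// mulrC -ler_pdivrMr//.
  by apply/ltW; rewrite /n; apply: truncnS_gt.
have tn0 : 0 <= t / n%:R by rewrite divr_ge0// ltW.
have -> : t = n%:R * (t / n%:R) by rewrite mulrC divfK// gt_eqF.
apply: (additive_nat_mul (P := fun s => Phi s p = p)) => //.
- exact: of_Phi0 flow _ _.
- by apply: per; rewrite tn0.
- by move=> a b a0 b0 pa pb; rewrite -(of_PhiD flow)// pb.
Qed.

(* The set of s with Phi_1 x <= Phi_s (Phi_1 x) is additive and contains an
   interval [T, T + e], hence it contains all large s. *)
Lemma convergence_criterion x (T : R) : X x -> 0 < T -> le x (Phi T x) ->
  x <> Phi T x -> forall a b, w x a -> w x b -> a = b.
Proof.
move=> Xx T0 xT nxT.
have XT : X (Phi T x) by exact: of_stable flow _ _ (ltW T0) Xx.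
have [e e0 eP] := of_strong flow (@ltr01 R) Xx XT xT nxT.
have [d d0 dP] : exists2 d : R, 0 < d & forall s, 0 <= s -> `|s - (1 + T)| < d ->
    ball (Phi (1 + T) x) e (Phi s x).
  by apply: flow_cont_time => //; lra.
set x1 := Phi 1 x.
have Xx1 : X x1 by exact: of_stable flow _ _ ler01 Xx.
pose G s := le x1 (Phi s x1).
have G0 : G 0 by rewrite /G (of_Phi0 flow)//; exact: of_refl flow _.
have GD a b : 0 <= a -> 0 <= b -> G a -> G b -> G (a + b).
  move=> a0 b0 Ga Gb; apply: (of_trans flow Ga).
  by rewrite -(of_PhiD flow)//; apply: (of_mono flow) => //;
    exact: of_stable flow _ _ b0 _.
have GT s : T <= s -> s < T + d -> G s.
  move=> Ts sd; have s0 : 0 <= s by lra.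
  apply: eP => //.
  - exact: of_stable flow _ _ _ _.
  - exact: ballxx.
  - rewrite !(of_PhiD flow)// ?ltW//; apply: dP; first lra.
    by rewrite ger0_norm; lra.
(* For [s >= S] and [n] the integer part of [s / T], one has [n > T / d], so [s / n] lies in
   [[T, T + d)]: [s] splits into [n] equal steps covered by [GT]. *)
pose S : R := T * (T / d + 1).
have Glarge s : S <= s -> G s.
  move=> Ss.
  have Td0 : 0 < T / d by rewrite divr_gt0.
  have sT : T / d + 1 <= s / T by rewrite ler_pdivlMr// mulrC.
  have s0 : 0 <= s by apply: le_trans Ss; rewrite mulr_ge0//; lra.
  pose n := Num.truncn (s / T).
  have /andP[n1 n2] : n%:R <= s / T < n.+1%:R.
    by apply: truncn_itv; rewrite divr_ge0// ltW.
  have Tdn : T / d < n%:R by move: n2; rewrite mulrSr; lra.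
  have n0 : 0 < n%:R :> R by exact: lt_trans Tdn.
  have -> : s = n%:R * (s / n%:R) by rewrite mulrC divfK// gt_eqF.
  apply: (additive_nat_mul (P := G)) => //.
  - apply: GT.
    + by rewrite ler_pdivlMr// mulrC -ler_pdivlMr.
    + rewrite ltr_pdivrMr//.
      have : s < n.+1%:R * T by rewrite -ltr_pdivrMr.
      have : T < n%:R * d by rewrite -ltr_pdivrMr.
      by rewrite mulrSr; nra.
  - by rewrite divr_ge0// ltW.
have main a b : w x a -> w x b -> le a b.
  move=> /omega_limitP[Xa xa] /omega_limitP[Xb xb].
  apply: (of_closed flow) => r r0.
  have [t [t1 t0 at_ _]] := xa r 1 r0.
  (* The time [s] is at least [S] after [t], so applying [Phi (t - 1)] to [G (s - t)] compares the
     two orbit points. *)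
  have [s [ss s0 bs _]] := xb r (Num.max (t + S) t) r0.
  move: ss; rewrite ge_max => /andP[tSs ts].
  exists (Phi t x), (Phi s x); split => //.
  have tt0 : 0 <= t - 1 by lra.
  have st0 : 0 <= s - t by lra.
  have -> : Phi t x = Phi (t - 1) x1 by rewrite (of_PhiD flow)// subrK.
  have -> : Phi s x = Phi (t - 1) (Phi (s - t) x1).
    rewrite /x1 (of_PhiD flow st0 ler01 Xx) (of_PhiD flow)//; last lra.
    by congr (Phi _ _); lra.
  apply: (of_mono flow) => //; first exact: of_stable flow _ _ _ _.
  by apply: Glarge; lra.
by move=> a b wa wb; apply: (of_anti flow); exact: main.
Qed.

Lemma omega_orbit x t p : X x -> 0 <= t -> w x p -> w (Phi t x) p.
Proof.
move=> Xx t0 /omega_limitP[Xp xp]; apply/omega_limitP; split => // e T e0.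
have [s [Ts s0 ps _]] := xp e (Num.max (T + t) t) e0.
move: Ts; rewrite ge_max => /andP[Ts ts].
have st : 0 <= s - t by lra.
by exists (s - t); split; rewrite ?(of_PhiD flow)// ?subrK//; lra.
Qed.

(** * Nonordering, colimiting and absorption *)

(** Were [p] and [q] distinct, the orbit would pass near [Phi 1 p] and later near [Phi 1 q], whose
    neighborhoods are ordered and disjoint. An orbit point would then lie strictly below a later
    one, and the convergence criterion would leave only one limit point. *)
Lemma omega_nonordering x p q : X x -> w x p -> w x q -> le p q -> p = q.
Proof.
move=> Xx wp wq pq; apply: contrapT => npq.
have Xp := omega_in wp; have Xq := omega_in wq.
have [e e0 eP] := of_strong flow ltr01 Xp Xq pq npq.
have [e' e'0 sep] := ball_separate (flow_strict Xp Xq pq npq ltr01).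
pose m := Num.min e e'; have m0 : 0 < m by rewrite lt_min e0.
have [me me'] : m <= e /\ m <= e' by rewrite /m !ge_min !lexx orbT.
have /omega_limitP[_ wp1] := omega_shift Xx ler01 wp.
have /omega_limitP[_ wq1] := omega_shift Xx ler01 wq.
have [t [_ t0 pt _]] := wp1 m 0 m0.
have [s [ts s0 qs _]] := wq1 m (t + 1) m0.
have sE : Phi s x = Phi (s - t) (Phi t x).
  by rewrite (of_PhiD flow)// ?subrK//; lra.
have Xt := of_stable flow t0 Xx; have Xs := of_stable flow s0 Xx.
apply: npq; apply: (@convergence_criterion (Phi t x) (s - t)) => //.
- by lra.
- by rewrite -sE; apply: eP => //; [exact: le_ball pt|exact: le_ball qs].
- by rewrite -sE; apply: sep; [exact: le_ball pt|exact: le_ball qs].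
- exact: omega_orbit.
- exact: omega_orbit.
Qed.

(** For small [s], strong monotonicity puts [Phi (1 + s) x] below [Phi 1 y] and [Phi 1 x] below
    [Phi (1 + s) y]. Flowing on and passing to the common limit bounds [Phi s p] by [p] on both
    sides, so all small [s] are periods of [p]. *)
Lemma colimiting_principle x y p : X x -> X y -> X p -> le x y -> x <> y ->
  colimit Phi x y p p -> equilibria X Phi p.
Proof.
move=> Xx Xy Xp xy nxy xyp.
have [e e0 eP] := of_strong flow ltr01 Xx Xy xy nxy.
have [d d0 dP] := flow_cont_time ler01 Xx e0.
have [d' d'0 d'P] := flow_cont_time ler01 Xy e0.
pose m := Num.min d d'; have m0 : 0 < m by rewrite lt_min d0.
have [md md'] : m <= d /\ m <= d' by rewrite /m !ge_min !lexx orbT.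
apply: (@small_periods_equilibrium _ (m / 2)) => // [|s /andP[s0 sm]].
  by rewrite divr_gt0.
have X1 := of_stable flow ler01.
have Xt z t : X z -> 0 <= t -> X (Phi t z) by move=> *; exact: of_stable flow _ _ _ _.
have sh z t : X z -> 0 <= t -> 1 <= t -> Phi s (Phi t z) = Phi (t - 1) (Phi (1 + s) z).
  move=> Xz t0 t1; have t10 : 0 <= t - 1 by lra.
  rewrite (of_PhiD flow s0 t0 Xz) (of_PhiD flow t10 _ Xz); last lra.
  by congr (Phi _ _); lra.
have sh0 z t : X z -> 0 <= t -> 1 <= t -> Phi t z = Phi (t - 1) (Phi 1 z).
  move=> Xz t0 t1; have t10 : 0 <= t - 1 by lra.
  by rewrite (of_PhiD flow t10 ler01 Xz) subrK.
have s10 : 0 <= 1 + s by lra.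
have norms : `|1 + s - 1| = s by rewrite addrAC subrr add0r ger0_norm.
have l1 : le (Phi s p) (Phi 0 p).
  apply: (colimit_le (T := 1)) xyp _ => // t t0 t1.
  rewrite (of_Phi0 flow (Xt _ _ Xy t0)) sh// (sh0 y)//.
  apply: (of_mono flow); rewrite ?subr_ge0//; [exact: Xt|exact: Xt|].
  apply: eP; [exact: Xt|exact: Xt| |exact: ballxx].
  by apply: dP => //; rewrite norms; lra.
have l2 : le (Phi 0 p) (Phi s p).
  apply: (colimit_le (T := 1)) xyp _ => // t t0 t1.
  rewrite (of_Phi0 flow (Xt _ _ Xx t0)) sh// (sh0 x)//.
  apply: (of_mono flow); rewrite ?subr_ge0//; [exact: Xt|exact: Xt|].
  apply: eP; [exact: Xt|exact: Xt|exact: ballxx|].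
  by apply: d'P => //; rewrite norms; lra.
by rewrite !(of_Phi0 flow Xp) in l1 l2; exact: (of_anti flow).
Qed.

(** A neighborhood of [Phi 1 a] lies below the image under [Phi 1] of the limit set of [v]. Once the
    orbit of [u] enters it, invariance of that limit set keeps the orbit below it, and limits
    inherit the inequality. *)
Lemma absorption u v a : X u -> X v -> cpt v -> w u a ->
  (forall z, w v z -> le a z /\ a <> z) ->
  forall b z, w u b -> w v z -> le b z /\ b <> z.
Proof.
move=> Xu Xv [A [cA AX Av]] ua av.
have Xa := omega_in ua.
have Xt z t : X z -> 0 <= t -> X (Phi t z).
  by move=> *; exact: of_stable flow _ _ _ _.
have [e e0 eP] : exists2 e : R, 0 < e & forall b, X b -> ball (Phi 1 a) e b ->
    forall z, w v z -> le b (Phi 1 z).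
  (* Uniformity in [z] by compactness: otherwise violating [z] would cluster at some [p] in [w v],
     against strong monotonicity applied to [a] and [p]. *)
  apply: contrapT => nex.
  have wA z : w v z -> A z.
    move=> /omega_limitP[_ vz].
    have clA := compact_closed (@norm_hausdorff _ V) cA.
    apply: clA => B /nbhs_ballP[e /= e0 eB].
    have [t [_ t0 zt _]] := vz e 0 e0.
    by exists (Phi t v); split; [exact: Av|exact: eB].
  have [||p Ap pP] := @compact_nested_cluster _ _ A
    (fun n z => w v z /\ exists b, [/\ X b, ball (Phi 1 a) n.+1%:R^-1 b &
      ~ le b (Phi 1 z)]) cA.
  - move=> n; apply: contrapT => nz; apply: nex; exists n.+1%:R^-1.
      by rewrite invr_gt0.
    move=> b Xb ab z vz; apply: contrapT => nbz; apply: nz.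
    by exists z; [exact: wA|split => //; exists b].
  - move=> n z [vz [b [Xb ab nbz]]]; split => //; exists b; split => //.
    by apply: le_ball ab; rewrite lef_pV2 ?posrE// ler_nat.
  have vp : w v p.
    apply: omega_closed => [|e e0]; first exact: AX.
    by have [z [_ [vz _] pz]] := pP e 0%N e0; exists z.
  have Xp := omega_in vp.
  have [lap nap] := av p vp.
  have [e e0 eP] := of_strong flow ltr01 Xa Xp lap nap.
  have [d d0 dP] := flow_cont_space ler01 Xp e0.
  have [N _ /(_ N (leqnn N)) /= Ne] := near_infty_natSinv_lt (PosNum e0).
  have [z [_ [/omega_in Xz [b [Xb ab nbz]]] pz]] := pP d N d0.
  apply: nbz; apply: eP => //; first exact: Xt.
    by apply: le_ball ab; exact: ltW.
  exact: dP.
have /omega_limitP[_ ua1] := omega_shift Xu ler01 ua.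
have [s [_ s0 as_ _]] := ua1 e 0 e0.
move=> b z ub vz.
have bz : le b z.
  have /omega_limitP[Xb ubb] := ub; have Xz := omega_in vz.
  apply: (of_closed flow) => r r0.
  have [t [st t0 bt _]] := ubb r s r0.
  exists (Phi t u), z; split; [exact: bt|exact: (ballxx z r0)|].
  have ts0 : 0 <= t - s by lra.
  have cv : cpt v by exists A.
  have [z1 vz1 z1E] := omega_preimage Xv cv ts0 vz.
  have [z2 vz2 z2E] := omega_preimage Xv cv ler01 vz1.
  have Xz2 := omega_in vz2.
  have -> : Phi t u = Phi (t - s) (Phi s u).
    by rewrite (of_PhiD flow ts0 s0 Xu) subrK.
  rewrite -z1E -z2E.
  apply: (of_mono flow) => //; [exact: Xt|exact: Xt|].
  by apply: eP => //; exact: Xt.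
(* Equality would put [a] below [b] inside [w u], hence [a = b = z] by nonordering. *)
split => // bzE; have [laz naz] := av z vz.
by apply: naz; rewrite -bzE in laz *; exact: omega_nonordering Xu ua ub laz.
Qed.

Lemma omega_sub_equilibria x y : X x -> X y -> le x y -> x <> y -> cpt x ->
  w y `<=` w x -> w y `<=` equilibria X Phi.
Proof.
move=> Xx Xy xy nxy cx yx q yq.
have [p [Xp xp xypq]] := colimit_exists cx yq.
have Xq := omega_in yq.
have pq : p = q.
  apply: (omega_nonordering Xx xp (yx q yq)).
  exact: colimit_mono xypq.
by rewrite pq in xypq; exact: colimiting_principle xypq.
Qed.

(** Nonordering identifies every limit point with [p], and forward invariance then fixes [p] under
    the flow. *)
Lemma omega_least_point x p : X x -> w x p -> (forall q, w x q -> le p q) ->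
  equilibria X Phi p /\ w x = [set p].
Proof.
move=> Xx xp lep; have eqp q : w x q -> q = p.
  by move=> xq; apply/esym; exact: (omega_nonordering Xx xp xq (lep q xq)).
split; last by apply/seteqP; split => [q /eqp //|q ->].
by split=> [|t t0]; [exact: omega_in xp|apply: eqp; exact: omega_shift].
Qed.

End Theory.

(** * Separation of the limit sets of ordered points *)

Section Dichotomy.
Variables (le : V -> V -> Prop) (X : set V) (Phi : R -> V -> V).
Hypothesis flow : ordered_flow le X Phi.
Local Notation w := (omega_limit X Phi).

Lemma omega_greatest_point x p : X x -> w x p -> (forall q, w x q -> le q p) ->
  equilibria X Phi p /\ w x = [set p].
Proof. exact: omega_least_point (ordered_flow_flip flow) _ _. Qed.

Lemma dual_absorption u v b : X u -> X v -> compact_orbit X Phi u -> w v b ->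
  (forall z, w u z -> le z b /\ z <> b) ->
  forall a c, w u a -> w v c -> le a c /\ a <> c.
Proof.
move=> Xu Xv cu vb ub a c ua vc.
have ub' z : w u z -> le z b /\ b <> z.
  by move=> /ub[zb nzb]; split => //; exact/nesym.
have [ac nac] := absorption (ordered_flow_flip flow) Xv Xu cu vb ub' vc ua.
by split => //; exact/nesym.
Qed.

(** For a colimit [p] paired with [q], continuation in [r] keeps [Phi r p] below [q]. So the limit
    set of [p], a part of [w x], lies strictly below [q], hence below all of [w y] by dual
    absorption; any of its points then starts absorption for [w x]. *)
Lemma omega_lt_of_notin x y q : X x -> X y -> le x y ->
  compact_orbit X Phi x -> compact_orbit X Phi y -> w y q -> ~ w x q ->
  forall a b, w x a -> w y b -> le a b /\ a <> b.
Proof.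
move=> Xx Xy xy cx cy yq nxq.
have Xt z t : X z -> 0 <= t -> X (Phi t z).
  by move=> *; exact: of_stable flow _ _ _ _.
have [p [Xp xp xypq]] := colimit_exists cx yq.
have Xq := omega_in yq.
have lim r T : 0 <= r -> (forall t, 0 <= t -> T <= t ->
    le (Phi r (Phi t x)) (Phi t y)) -> le (Phi r p) q.
  move=> r0 H; rewrite -(of_Phi0 flow Xq).
  apply: (colimit_le flow (T := T)) xypq _ => // t t0 Tt.
  by rewrite (of_Phi0 flow (Xt _ _ Xy t0)); exact: H.
(* One threshold [T] serves all shifts in [[0, r]], so a continuation step has to treat only shifts
   close to [r]. *)
pose P r := exists T : R, forall t, 0 <= t -> T <= t -> forall s, 0 <= s <= r ->
  le (Phi s (Phi t x)) (Phi t y).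
have P0 : P 0.
  exists 0 => t t0 _ s; rewrite -eq_le => /eqP <-.
  by rewrite (of_Phi0 flow (Xt _ _ Xx t0)); exact: of_mono flow _ _ _ t0 Xx Xy xy.
have allP r : 0 <= r -> P r.
  move: r; apply: real_induction => r r0 IH.
  have near_r d : 0 < d -> exists r1, [/\ 0 <= r1, P r1, `|r1 - r| < d & r - d < r1].
    move=> d0; have [rd|rd] := leP r (d / 2).
      by exists 0; split => //; [rewrite add0r normrN ger0_norm//; lra|lra].
    exists (r - d / 2); split; [lra|by apply: IH; apply/andP; split; lra| |lra].
    by rewrite addrAC subrr add0r normrN gtr0_norm; lra.
  have lrq : le (Phi r p) q.
    apply: (of_closed flow) => e e0.
    have [d d0 dP] := flow_cont_time flow r0 Xp e0.
    have [r1 [r10 [T Pr1] r1d _]] := near_r d d0.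
    exists (Phi r1 p), q; split; [exact: dP|exact: (ballxx q e0)|].
    by apply: (lim _ T) => // t t0 Tt; apply: Pr1; rewrite ?r10 /=.
  (* [Phi r p] belongs to [w x] and [q] does not; this strictness lets strong monotonicity carry the
     comparison past [r]. *)
  have nrq : Phi r p <> q.
    by move=> rq; apply: nxq; rewrite -rq; exact: (omega_shift flow).
  have [e e0 eP] := of_strong flow ltr01 (Xt _ _ Xp r0) Xq lrq nrq.
  have r10 : 0 <= 1 + r by lra.
  have [d d0 dP] := of_cont flow r10 Xp e0.
  have [d' d'0 d'P] := flow_cont_space flow ler01 Xq e0.
  have [|t [_ t0 pt qt]] := xypq (Num.min d d') 0; first by rewrite lt_min d0.
  have d20 : 0 < d / 2 by rewrite divr_gt0.
  have [r1 [r1p [T Pr1] _ r1d]] := near_r _ d20.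
  exists (d / 2) => // r' /andP[rr' r'd].
  exists (Num.max T (t + 1)) => t' t'0.
  rewrite ge_max => /andP[Tt' tt'] s /andP[s0 sr'].
  (* Shifts up to [r1] are covered by [P r1]; those in [(r1, r']] are within [d] of [r], are
     compared at time [t] and carried on to [t'] by monotonicity. *)
  have [sr1|r1s] := leP s r1; first by apply: Pr1; rewrite ?s0.
  have tt0 : 0 <= t' - (t + 1) by lra.
  have s10 : 0 <= 1 + s by lra.
  have t10 : 0 <= t + 1 by lra.
  have -> : Phi t' y = Phi (t' - (t + 1)) (Phi 1 (Phi t y)).
    rewrite (of_PhiD flow ler01 t0 Xy) (of_PhiD flow tt0 _ Xy); last lra.
    by congr (Phi _ _); lra.
  have -> : Phi s (Phi t' x) = Phi (t' - (t + 1)) (Phi (1 + s) (Phi t x)).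
    rewrite (of_PhiD flow s10 t0 Xx) (of_PhiD flow tt0 _ Xx); last lra.
    by rewrite (of_PhiD flow s0 t'0 Xx); congr (Phi _ _); lra.
  have Xsx := Xt _ _ (Xt _ _ Xx t0) s10; have X1y := Xt _ _ (Xt _ _ Xy t0) ler01.
  apply: (of_mono flow) => //.
  apply: eP => //.
  - rewrite (of_PhiD flow ler01 r0 Xp); apply: dP => //; first exact: Xt.
      by rewrite ltr_norml; apply/andP; split; lra.
    by apply: le_ball pt; rewrite ge_min lexx.
  - apply: d'P; first exact: Xt.
    by apply: le_ball qt; rewrite ge_min lexx orbT.
have rq r : 0 <= r -> le (Phi r p) q.
  move=> r0; have [T PT] := allP r r0.
  by apply: (lim _ T) => // t t0 Tt; apply: PT; rewrite // r0 lexx.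
have sub a : w p a -> w x a.
  move=> /omega_limitP[Xa pa]; apply: omega_closed => // e e0.
  have [t [_ t0 at_ _]] := pa e 0 e0.
  by exists (Phi t p) => //; exact: (omega_shift flow).
have [A [cA AX Ax]] := cx.
have cp : compact_orbit X Phi p.
  exists A; split => // t t0.
  have clA := compact_closed (@norm_hausdorff _ V) cA.
  apply: clA => B /nbhs_ballP[e /= e0 eB].
  have /omega_limitP[_ xtp] := omega_shift flow Xx t0 xp.
  have [s [_ s0 st _]] := xtp e 0 e0.
  by exists (Phi s x); split; [exact: Ax|exact: eB].
have lpq z : w p z -> le z q /\ z <> q.
  move=> pz; split; last by move=> zq; apply: nxq; rewrite -zq; exact: sub.
  have /omega_limitP[Xz zz] := pz.
  apply: (of_closed flow) => e e0; have [t [_ t0 zt _]] := zz e 0 e0.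
  exists (Phi t p), q; split; [by []|exact: (ballxx q e0)|exact: rq].
have [c wc] := omega_nonempty cp.
apply: (absorption flow Xx Xy cy (sub _ wc)) => z yz.
exact: (dual_absorption Xp Xy cp yq lpq wc yz).
Qed.

Lemma limit_set_separation x y : X x -> X y -> le x y -> x <> y ->
  compact_orbit X Phi x -> compact_orbit X Phi y ->
  ~ (w y `<=` equilibria X Phi) ->
  forall a b, w x a -> w y b -> le a b /\ a <> b.
Proof.
move=> Xx Xy xy nxy cx cy nyE.
have [q] : exists q, ~ (w y q -> w x q).
  apply: contrapT => H; apply: nyE.
  apply: (omega_sub_equilibria flow Xx Xy xy nxy cx) => q yq.
  by apply: contrapT => nxq; apply: H; exists q => /(_ yq).
move=> /not_implyP[yq nxq].
exact: omega_lt_of_notin yq nxq.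
Qed.

(** Accumulation is tested on each side of [s]: values [p s'] with [s' < s] push [p s] to the bottom
    of its limit set, those with [s' > s] to the top, and either way the limit set is a single
    equilibrium. *)
Lemma omega_chain_isolated (D : set R) (x p : R -> V) :
  (forall s, D s -> X (x s)) -> (forall s, D s -> w (x s) (p s)) ->
  (forall s s' a b, D s -> D s' -> s < s' -> w (x s) a -> w (x s') b -> le a b) ->
  forall s, D s -> ~ (exists2 e, equilibria X Phi e & w (x s) = [set e]) ->
  exists2 e : R, 0 < e & forall s', D s' -> ball (p s) e (p s') -> s' = s.
Proof.
move=> DX Dp sep s Ds nconv.
have one_sided (Q : set R) : ~ (forall e : R, 0 < e ->
      exists s', [/\ D s', Q s' & ball (p s) e (p s')]) ->
    exists2 e : R, 0 < e & forall s', D s' -> Q s' -> ~ ball (p s) e (p s').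
  move=> H; apply: contrapT => nex; apply: H => e e0.
  apply: contrapT => ns'; apply: nex; exists e => // s' Ds' Qs' pp.
  by apply: ns'; exists s'.
have [e e0 below] : exists2 e : R, 0 < e &
    forall s', D s' -> s' < s -> ~ ball (p s) e (p s').
  apply: (one_sided [set s' | s' < s]) => acc; apply: nconv.
  have lep q : w (x s) q -> le (p s) q.
    move=> sq; apply: (of_closed flow) => e e0.
    have [s' [Ds' s's pp]] := acc e e0.
    exists (p s'), q; split; [exact: pp|exact: (ballxx q e0)|].
    exact: sep Ds' Ds s's (Dp _ Ds') sq.
  have [Ep wE] := omega_least_point flow (DX s Ds) (Dp s Ds) lep.
  by exists (p s).
have [e' e'0 above] : exists2 e : R, 0 < e &
    forall s', D s' -> s < s' -> ~ ball (p s) e (p s').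
  apply: (one_sided [set s' | s < s']) => acc; apply: nconv.
  have gep q : w (x s) q -> le q (p s).
    move=> sq; apply: (of_closed flow) => r r0.
    have [s' [Ds' s's pp]] := acc r r0.
    exists q, (p s'); split; [exact: (ballxx q r0)|exact: pp|].
    exact: sep Ds Ds' s's sq (Dp _ Ds').
  have [Ep wE] := omega_greatest_point (DX s Ds) (Dp s Ds) gep.
  by exists (p s).
exists (Num.min e e') => [|s' Ds' pp]; first by rewrite lt_min e0.
have [s's|ss'|//] := ltgtP s' s.
- by case: (below s' Ds' s's); apply: le_ball pp; rewrite ge_min lexx.
- by case: (above s' Ds' ss'); apply: le_ball pp; rewrite ge_min lexx orbT.
Qed.

End Dichotomy.
End Flow.

(** * From cones to order relations *)

Lemma cone_ordered_flow (R : realType) (V : normedModType R) (K X : set V)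
    (Phi : R -> V -> V) :
  order_cone K -> semiflow X Phi -> strongly_monotone_semiflow K X Phi ->
  ordered_flow (cone_le K) X Phi.
Proof.
case=> clK cvxK scK ptK _ [st ct P0 PD] [mono strong].
have K0 : K 0 by have : [set 0 : V] 0 by []; rewrite -ptK => -[].
(* The sum is twice the midpoint, which convexity provides. *)
have KD a b : K a -> K b -> K (a + b).
  move=> Ka Kb; have h0 : 0 <= 2^-1 :> R by rewrite invr_ge0.
  have h1 : 2^-1 <= 1 :> R by rewrite invf_le1// ler1n.
  have := cvxK a b (Itv01 h0 h1); rewrite !inE => /(_ Ka Kb).
  move=> /(scK 2 _ (ler0n _ _)); congr K.
  change (2 *: ((2^-1 : R) *: a + (1 - 2^-1 : R) *: b) = a + b).
  rewrite scalerDr !scalerA divff// scale1r; congr (_ + _).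
  have -> : 2 * (1 - 2^-1) = 1 :> R by lra.
  exact: scale1r.
split => //.
- by move=> x; rewrite /cone_le subrr.
- move=> y x z xy yz; rewrite /cone_le.
  by have := KD _ _ yz xy; rewrite addrA subrK.
- move=> x y xy yx; apply/eqP; rewrite -subr_eq0; apply/eqP.
  have : (K `&` [set - z | z in K]) (x - y).
    by split => //; exists (y - x); rewrite ?opprB.
  by rewrite ptK.
- move=> x y H; apply: clK => B /nbhs_ballP[e /= e0 eB].
  have [a [b [xa yb ab]]] := H (e / 2) (divr_gt0 e0 (ltr0n _ 2)).
  exists (b - a); split => //; apply: eB.
  move: xa yb; rewrite -!ball_normE /= => xa yb.
  have -> : y - x - (b - a) = (y - b) - (x - a).
    by rewrite !opprB addrACA [RHS]addrACA; congr (_ + _); rewrite addrC.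
  by rewrite (le_lt_trans (ler_normB _ _))//; lra.
- move=> t x e t0 Xx e0.
  have /subspace_continuousP/(_ (t, x)) := ct.
  move=> /(_ (conj t0 Xx)) /cvg_ballP /(_ e e0).
  rewrite near_withinE => /nbhs_ballP[d /= d0 dP].
  exists d => // s z s0 Xz std xz.
  apply: (dP (s, z)) => //; split => //=.
  by rewrite -ball_normE /= distrC.
- by move=> t x y t0 Xx Xy xy; exact: mono.
- move=> t x y t0 Xx Xy xy nxy.
  have [U [U' [[oU Ux] [oU' U'y] UU']]] := strong x y Xx Xy (conj xy nxy) t t0.
  have /nbhs_ballP[d /= d0 dU] := open_nbhs_nbhs (conj oU Ux).
  have /nbhs_ballP[d' /= d'0 dU'] := open_nbhs_nbhs (conj oU' U'y).
  exists (Num.min d d') => [|a b Xa Xb ta tb]; first by rewrite lt_min d0.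
  apply: UU'; split => //.
    by apply: dU; apply: le_ball ta; rewrite ge_min lexx.
  by apply: dU'; apply: le_ball tb; rewrite ge_min lexx orbT.
Qed.

(** * Countability and shyness *)

Lemma isolated_family_countable (R : realType) (V : normedModType R) (T : pointedType)
    (D : set T) (f : T -> V) : separable V ->
  (forall s, D s -> exists2 e : R, 0 < e &
     forall s', D s' -> ball (f s) e (f s') -> s' = s) -> countable D.
Proof.
move=> [Q cQ dQ] iso.
(* Two members of [F n q] have values within [2 / (n + 1)] of each other, inside the isolation
   radius, so each piece has at most one element; density of [Q] makes the pieces cover [D]. *)
pose F (n : nat) q := [set s | [/\ D s, ball q n.+1%:R^-1 (f s) &
  forall s', D s' -> ball (f s) (n.+1%:R^-1 + n.+1%:R^-1) (f s') -> s' = s]].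
apply: (@sub_countable _ _ _ (\bigcup_n \bigcup_(q in Q) F n q)).
  apply: subset_card_le => s Ds.
  have [e e0 eP] := iso s Ds.
  have e20 : 0 < e / 2 by rewrite divr_gt0.
  have [N _ /(_ N (leqnn N)) /= Ne] := near_infty_natSinv_lt (PosNum e20).
  have [||q [sq Qq]] := dQ (ball (f s) N.+1%:R^-1).
  - by exists (f s); apply: ballxx; rewrite invr_gt0.
  - by apply: ball_open; rewrite invr_gt0.
  exists N => //; exists q => //; split => //; first exact: ball_sym.
  move=> s' Ds' ss'; apply: eP => //; apply: le_ball ss'.
  by rewrite [leRHS]splitr lerD// ltW.
apply: bigcup_countable => // n _; apply: bigcup_countable => // q _.
have [[s sF]|F0] := pselect (F n q !=set0); last first.
  have -> : F n q = set0 by apply/seteqP; split => // s sF; apply: F0; exists s.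
  exact: countable0.
apply: (@sub_countable _ _ _ [set s]) => //; apply: subset_card_le => s' [Ds' qs' s'P].
have [Ds qs _] := sF; rewrite /=; apply/esym; apply: s'P => //.
exact: ball_triangle (ball_sym qs') qs.
Qed.

Section SegmentMeasure.
Context {R : realType} {V : completeNormedModType R} (v : V).
Local Open Scope ereal_scope.
Local Notation l := (fun s : R => (s *: v)%R).

(** The push-forward to [V] of Lebesgue measure on the unit interval. *)
Definition segment_measure (A : set (@borelType R V)) : \bar R :=
  lebesgue_measure ((`[0%R, 1%R] : set R) `&` l @^-1` A).

Lemma scale_continuous_left : continuous (l : R -> V).
Proof. by move=> s; apply: cvgZr_tmp; exact: cvg_id. Qed.

Lemma segment_preimage_measurable (A : set (@borelType R V)) : measurable A ->
  measurable ((`[0%R, 1%R] : set R) `&` l @^-1` A).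
Proof.
move=> mA; apply: measurableI; first exact: measurable_itv.
have ml : measurable_fun [set: R] (l : R -> @borelType R V).
  apply: (@measurability _ _ _ (@borelType R V) setT _ (@open V)) => //.
  move=> _ [U oU <-]; rewrite setTI.
  apply: open_measurable; move/continuousP: scale_continuous_left; exact.
by rewrite -[X in measurable X]setTI; exact: ml.
Qed.

Let segment_measure0 : segment_measure set0 = 0.
Proof. by rewrite /segment_measure preimage_set0 setI0 measure0. Qed.

Let segment_measure_ge0 A : 0 <= segment_measure A.
Proof. exact: measure_ge0. Qed.

Let segment_measure_sigma_additive : semi_sigma_additive segment_measure.
Proof.
move=> F mF tF mUF; rewrite /segment_measure preimage_bigcup setI_bigcupr.
apply: measure_semi_sigma_additive.
- by move=> n; exact: segment_preimage_measurable.
- move=> i j _ _ [s [[_ Fi] [_ Fj]]].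
  by apply: tF => //; exists (s *: v)%R.
- by rewrite -setI_bigcupr -preimage_bigcup; exact: segment_preimage_measurable.
Qed.

HB.instance Definition _ := isMeasure.Build _ _ _ segment_measure
  segment_measure0 segment_measure_ge0 segment_measure_sigma_additive.

Let segment_measure_finite : fin_num_fun segment_measure.
Proof.
move=> A mA; rewrite ge0_fin_numE//.
have m01 : measurable (`[0%R, 1%R] : set R) by exact: measurable_itv.
apply: (@le_lt_trans _ _ (lebesgue_measure (`[0%R, 1%R] : set R))).
  apply: le_measure; rewrite ?inE//; exact: segment_preimage_measurable.
by rewrite lebesgue_measure_itv/= lte_fin ltr01 -EFinB ltry.
Qed.

HB.instance Definition _ := Measure_isFinite.Build _ _ _ segment_measure
  segment_measure_finite.

End SegmentMeasure.

Lemma shy_of_countable_lines (R : realType) (V : completeNormedModType R)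
    (W : set V) (v : V) : v <> 0 ->
  (forall x, countable [set s : R | W (x + s *: v)]) -> shy W.
Proof.
move=> v0 cW.
have inj (s s' : R) : s *: v = s' *: v -> s = s'.
  move=> /eqP; rewrite -subr_eq0 -scalerBl scaler_eq0 subr_eq0.
  by move=> /orP[/eqP //|/eqP].
pose C := (fun s : R => s *: v) @` (`[0, 1] : set R).
have cC : compact C.
  apply: continuous_compact; last exact: segment_compact.
  by apply: continuous_subspaceT; exact: scale_continuous_left.
have clC : closed C by exact: compact_closed (@norm_hausdorff _ V) cC.
exists (segment_measure v); split.
- rewrite /= /segment_measure preimage_setT setIT lebesgue_measure_itv/=.
  by rewrite lte_fin ltr01 -EFinB subr0 => /eqP; rewrite eqe oner_eq0.
- exists C => //; rewrite /= /segment_measure.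
  rewrite (_ : _ `&` _ = set0) ?measure0//.
  by apply/seteqP; split => // s [s01]; apply; exists s.
(* [s *: v] lies in the translate of [W] by [x] iff [- x + s *: v] lies in [W], so the relevant line
   passes through [- x]. *)
- move=> x; pose D := [set s : R | W (- x + s *: v)].
  exists (~` C `|` (fun s : R => s *: v) @` D); split.
  + apply: measurableU.
      by apply: sub_sigma_algebra; rewrite /= openC.
    apply: countable_measurable => [t|].
      rewrite -[X in measurable X]setCK; apply: measurableC.
      apply: sub_sigma_algebra; rewrite /= openC.
      exact: accessible_closed_set1 (hausdorff_accessible (@norm_hausdorff _ V)) _.
    exact: (sub_countable (card_image_le _ _) (cW (- x))).
  + rewrite /= /segment_measure; apply: countable_lebesgue_measure0.
    apply: (@sub_countable _ _ _ D); last exact: cW.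
    apply: subset_card_le => s [s01 [nC|[s' Ds' /inj <-]]] //.
    by case: nC; exists s.
  + move=> _ [z Wz <-].
    have [[s s01 sE]|nC] := pselect (C (z + x)); last by left.
    right; exists s => //; rewrite /D /= sE addrC.
    by rewrite addrK.
Qed.

(** * Prevalence of quasiconvergence and convergence *)

(** The common core of both claims, where [S] consists of the points of compact orbit closure that
    are not quasiconvergent, respectively not convergent. *)
Lemma shy_of_ordered_omega (R : realType) (V : completeNormedModType R)
    (K X S : set V) (Phi : R -> V -> V) : separable V -> order_cone K ->
  ordered_flow (cone_le K) X Phi -> S `<=` X -> S `<=` compact_orbit X Phi ->
  (forall x, S x -> ~ exists2 e, equilibria X Phi e & omega_limit X Phi x = [set e]) ->
  (forall x y, S x -> S y -> cone_lt K x y ->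
     set_le K (omega_limit X Phi x) (omega_limit X Phi y)) -> shy S.
Proof.
move=> sepV coneK flow SX Scpt Snconv Ssep.
have [v Kv v0] : exists2 v, K v & v <> 0.
  apply: contrapT => nv; case: coneK => _ _ _ ptK; apply.
  apply/seteqP; split => [v Kv|_ ->].
    by apply: contrapT => v0; apply: nv; exists v.
  by have : [set 0 : V] 0 by []; rewrite -ptK => -[].
apply: (shy_of_countable_lines v0) => x.
set D := [set s | _].
have /choice[p pP] : forall s, exists p, D s -> omega_limit X Phi (x + s *: v) p.
  move=> s; have [Ds|nDs] := pselect (D s); last by exists 0.
  by have [p wp] := omega_nonempty (Scpt _ Ds); exists p.
apply: (isolated_family_countable (f := p)) => // s Ds.
apply: (omega_chain_isolated flow (x := fun s => x + s *: v)) => //.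
- by move=> r Dr; exact: SX.
- move=> r r' a b Dr Dr' rr' wa wb.
  apply: (Ssep (x + r *: v) (x + r' *: v)) => //; split.
    rewrite /cone_le [x + r' *: v]addrC addrKA -scalerBl.
    by apply: (order_cone_scale coneK) => //; rewrite subr_ge0 ltW.
  move=> /addrI /eqP; rewrite -subr_eq0 -scalerBl scaler_eq0 subr_eq0.
  by rewrite lt_eqF//= => /eqP.
- exact: Snconv.
Qed.

Theorem theorem4 (R : realType) (V : completeNormedModType R)
    (sepV : separable V)
    (K : set V) (coneK : order_cone K) (intK : interior K !=set0)
    (X : set V) (Phi : R -> V -> V) (flowPhi : semiflow X Phi)
    (monoPhi : strongly_monotone_semiflow K X Phi) :
  prevalent_in (quasiconvergent_points X Phi) (compact_orbit_points X Phi) /\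
  (improved_limit_set_dichotomy K X Phi ->
   prevalent_in (convergent_points X Phi) (compact_orbit_points X Phi)).
Proof.
have flow := cone_ordered_flow coneK flowPhi monoPhi.
have cpt x : compact_orbit_points X Phi x -> compact_orbit X Phi x.
  move=> [Xx cx]; exists (closure (Defs.orbit Phi x) `&` X); split => //.
  move=> t t0; split; last exact: semiflow_stable flowPhi _ _ t0 Xx.
  by apply: subset_closure; exists t.
split=> [|ILSD]; apply: (shy_of_ordered_omega sepV coneK flow).
- by move=> x [[]].
- by move=> x [/cpt].
- move=> x [[Xx _] nQ] [e Ee wE]; apply: nQ; split => //.
  by rewrite wE => _ ->.
- move=> x y [Bx nQx] [By nQy] [xy nxy] a b wa wb.
  have [Xx _] := Bx; have [Xy _] := By.
  have nE : ~ (omega_limit X Phi y `<=` equilibria X Phi).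
    by move=> yE; apply: nQy.
  by have [] := limit_set_separation flow Xx Xy xy nxy (cpt _ Bx) (cpt _ By) nE wa wb.
- by move=> x [[]].
- by move=> x [/cpt].
- by move=> x [[Xx _] nC] H; apply: nC.
- move=> x y [[Xx _] nCx] [[Xy _] nCy] xy a b wa wb.
  (* The second alternative would make [x] convergent. *)
  have [lt|[e Ee [wx wy]]] := ILSD x y Xx Xy xy; first by have [] := lt a b wa wb.
  by case: nCx; split => //; exists e.
Qed.
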